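(* Let $L_1\in\mathbb{R}^{p\times p}$ and $L_2\in\mathbb{R}^{q\times q}$ be real symmetric positive semi-definite matrices, let $Y\in\mathbb{R}^{p\times q}$ be a real matrix, and let $$M=\begin{bmatrix}-L_1&-Y&L_1\\-Y^TL_1&-Y^TY-L_2&Y^TL_1\\0&Y&-L_1\end{bmatrix}\in\mathbb{R}^{(2p+q)\times(2p+q)}.$$ Then: (i) every non-zero (complex) eigenvalue of $M$ has negative real part; (ii) the zero eigenvalue of $M$ (if $0$ is an eigenvalue) is non-defective, that is, its algebraic multiplicity equals its geometric multiplicity. *)

(* Defs.v *)
From HB Require Import structures.
From mathcomp Require Import all_boot all_order all_algebra.
From mathcomp Require Import reals complex.

Set Implicit Arguments.
Unset Strict Implicit.
Unset Printing Implicit Defensive.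

Import Order.TTheory GRing.Theory Num.Theory.
Local Open Scope ring_scope.

Definition psdmx (R : realType) (n : nat) (L : 'M[R]_n) : Prop :=
  L \is symmetricmx /\ forall x : 'cV[R]_n, 0 <= (x^T *m L *m x) 0 0.

(* The index type is associated as (p + q) + p. *)
Definition Mmx (R : realType) (p q : nat)
    (L1 : 'M[R]_p) (L2 : 'M[R]_q) (Y : 'M[R]_(p, q)) : 'M[R]_(p + q + p) :=
  block_mx
    (block_mx    (- L1)             (- Y)
              (- (Y^T *m L1)) (- (Y^T *m Y) - L2))   (col_mx L1 (Y^T *m L1))
    (row_mx       0                  Y)                    (- L1).

Definition cmx (R : realType) (m n : nat) (A : 'M[R]_(m, n)) : 'M[R[i]]_(m, n) :=
  map_mx (real_complex R) A.

Definition alg_mult (F : fieldType) (n : nat) (A : 'M[F]_n) (a : F) : nat :=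
  mup a (char_poly A).

(* [eigenvalue] and [eigenspace] are phrased with row vectors;
   [eigenvalue_colP] and [geom_mult_col] show that for square matrices the
   column-vector convention gives the same eigenvalues and multiplicities. *)
Definition geom_mult (F : fieldType) (n : nat) (A : 'M[F]_n) (a : F) : nat :=
  \rank (eigenspace A a).

Lemma geom_mult_col (F : fieldType) (n : nat) (A : 'M[F]_n) (a : F) :
  geom_mult A^T a = geom_mult A a.
Proof.
by rewrite /geom_mult !mxrank_ker -(tr_scalar_mx n a) -linearB /= mxrank_tr tr_scalar_mx.
Qed.

Lemma eigenvalue_colP (F : fieldType) (n : nat) (A : 'M[F]_n) (a : F) :
  reflect (exists2 v : 'cV[F]_n, A *m v = a *: v & v != 0) (eigenvalue A a).
Proof.
have -> : eigenvalue A a = eigenvalue A^T a.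
  by rewrite /eigenvalue -!mxrank_eq0 -/(geom_mult _ _) -geom_mult_col.
apply: (iffP eigenvalueP) => [] [v Av vn0]; exists v^T; rewrite ?trmx_eq0 //.
  by apply: trmx_inj; rewrite trmx_mul trmxK Av linearZ /= trmxK.
by rewrite -trmx_mul Av linearZ.
Qed.

(* Main.v *)
(* Let (x, y, w) be an eigenvector for z != 0, write A = L1, B = L2, <u, v> for
   the Hermitian inner product and N = |z|^2. Adding the first and third block
   rows, and using the first in the second, gives
   - A x = z (x + w) and z Y^* x - B y = z y. Pairing with x, A x, y yields
     z N <x, x> + 2 N <x, A x> + N <y, y> + z <y, B y> + z^* <A x, A x> = 0.
   If Re z >= 0, the real part forces y = 0; then w and x are eigenvectors of
   - A for z or vanish, and they vanish because - A is negative semi-definite.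

   Similar pairings show ker M^2 = ker M. Factor M = U V through its
   rank r; then V U is invertible, and Sylvester's identity
   X^r det (X - U V) = X^n det (X - V U) shows that 0 is a root of char_poly M
   of multiplicity n - r. *)
Require Import Defs.
From mathcomp Require Import all_boot all_order all_algebra.
From mathcomp Require Import reals complex.
From mathcomp Require Import spectral sesquilinear ring.

Import Order.TTheory GRing.Theory Num.Theory.
Local Open Scope ring_scope.
Local Open Scope sesquilinear_scope.

Set Implicit Arguments.
Unset Strict Implicit.
Unset Printing Implicit Defensive.

(** * Sylvester's determinant identity and the multiplicity of the eigenvalue zero *)

(** Two block-triangular multipliers turn one matrix [T] into block-triangular form, giving two
    values for its determinant. Nothing is divided by [a], so [a] may be the polynomial ['X]. *)
Lemma det_scalar_sub_mulmxC (R : comPzRingType) (m n : nat) (a : R)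
    (A : 'M[R]_(m, n)) (B : 'M[R]_(n, m)) :
  a ^+ n * \det (a%:M - A *m B) = a ^+ m * \det (a%:M - B *m A).
Proof.
pose T := block_mx a%:M A B 1%:M.
have EA : T *m block_mx 1%:M 0 (- B) 1%:M = block_mx (a%:M - A *m B) A 0 1%:M.
  by rewrite mulmx_block !(mulmx1, mulmx0, mul1mx, mulmxN, add0r) subrr.
have EB : T *m block_mx 1%:M (- A) 0 a%:M = block_mx a%:M 0 B (a%:M - B *m A).
  rewrite mulmx_block !(mulmx1, mulmx0, mul1mx, mulmxN, addr0).
  by rewrite scalar_mxC addNr addrC.
have := congr1 (fun X => \det X * a ^+ n) EA.
have := congr1 determinant EB.
rewrite !det_mulmx !(det_lblock, det_ublock) !det1 !det_scalar !mul1r !mulr1.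
by move=> -> ->; rewrite mulrC.
Qed.

Lemma eigenspace0 (F : fieldType) (n : nat) (A : 'M[F]_n) : eigenspace A 0 = kermx A.
Proof. by rewrite /eigenspace raddf0 subr0. Qed.

Lemma alg_mult0_rank_sq (F : fieldType) (n : nat) (A : 'M[F]_n) :
  \rank (A *m A) = \rank A -> alg_mult A 0 = geom_mult A 0.
Proof.
move=> rAA; pose r := \rank A; pose U := col_base A; pose V := row_base A.
(* Since [A *m A] is [U *m (V *m U) *m V], its rank [r] is at most that of the [r] by [r] matrix
   [V *m U]. *)
have VU_unit : V *m U \in unitmx.
  rewrite -row_free_unit /row_free eqn_leq rank_leq_row.
  have AA : A *m A = U *m (V *m U) *m V by rewrite -{1 2}(mulmx_base A) !mulmxA.
  rewrite -[X in (X <= _)%N]rAA AA.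
  exact: leq_trans (mxrankM_maxl _ _) (mxrankM_maxr _ _).
have E : 'X ^+ r * char_poly A = 'X ^+ n * char_poly (V *m U).
  have -> : char_poly A = char_poly (U *m V) by rewrite mulmx_base.
  rewrite /char_poly /char_poly_mx !map_mxM.
  exact: det_scalar_sub_mulmxC.
have nz k (B : 'M[F]_k) : char_poly B != 0 by rewrite monic_neq0 ?char_poly_monic.
have mupXn k : mup 0 ('X ^+ k : {poly F}) = k.
  by have := mup_XsubCX k (0 : F) 0; rewrite subr0 eqxx.
(* The root 0 has multiplicity [r + alg_mult A 0] on the left and [n] on the right, because
   invertible [V *m U] does not have eigenvalue 0. *)
have := congr1 (mup 0) E.
rewrite !mupM ?expf_neq0 ?polyX_eq0 ?nz // !mupXn [mup 0 (char_poly (_ *m _))]mupNroot.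
  rewrite addn0 /alg_mult /geom_mult eigenspace0 mxrank_ker => Er.
  by rewrite -[X in (X - _)%N]Er addKn.
rewrite -eigenvalue_root_char /eigenvalue eigenspace0 negbK.
by rewrite kermx_eq0 row_free_unit.
Qed.

(** Rank-nullity, applied to transposes because [kermx] is a space of row vectors. *)
Lemma rank_sq_ker (F : fieldType) (n : nat) (A : 'M[F]_n) :
  (forall v : 'cV_n, A *m (A *m v) = 0 -> A *m v = 0) -> \rank (A *m A) = \rank A.
Proof.
move=> kerAA; apply/eqP; rewrite eqn_leq mxrankM_maxl /=.
rewrite -(mxrank_tr A) -(mxrank_tr (A *m A)).
have: (kermx (A *m A)^T <= kermx A^T)%MS.
  apply/row_subP => i; apply/sub_kermxP; apply: trmx_inj.
  rewrite trmx_mul trmxK trmx0; apply: kerAA.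
  have /sub_kermxP/(congr1 trmx) := row_sub i (kermx (A *m A)^T).
  by rewrite trmx_mul trmxK trmx0 mulmxA.
move/mxrankS; rewrite !mxrank_ker.
have := rank_leq_row A^T; have := rank_leq_row (A *m A)^T.
by move=> h1 h2; rewrite leq_sub2lE.
Qed.

(** * The Hermitian inner product on column vectors *)

Section Hermitian.
Variable C : numClosedFieldType.

Definition dotc (n : nat) (u v : 'cV[C]_n) : C := (u^t* *m v) 0 0.

Lemma dotcE (n : nat) (u v : 'cV[C]_n) : dotc u v = \sum_i (u i 0)^* * v i 0.
Proof. by rewrite /dotc mxE; apply: eq_bigr => i _; rewrite !mxE. Qed.

Lemma dotcDr (n : nat) (u v w : 'cV[C]_n) : dotc u (v + w) = dotc u v + dotc u w.
Proof. by rewrite /dotc mulmxDr mxE. Qed.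

Lemma dotcNr (n : nat) (u v : 'cV[C]_n) : dotc u (- v) = - dotc u v.
Proof. by rewrite /dotc mulmxN mxE. Qed.

Lemma dotcZr (n : nat) (a : C) (u v : 'cV[C]_n) : dotc u (a *: v) = a * dotc u v.
Proof. by rewrite /dotc -scalemxAr mxE. Qed.

Lemma dotc0r (n : nat) (u : 'cV[C]_n) : dotc u 0 = 0.
Proof. by rewrite /dotc mulmx0 mxE. Qed.

Lemma dotc0l (n : nat) (u : 'cV[C]_n) : dotc 0 u = 0.
Proof. by rewrite /dotc trmx0 map_mx0 mul0mx mxE. Qed.

Lemma dotcC (n : nat) (u v : 'cV[C]_n) : dotc v u = (dotc u v)^*.
Proof.
rewrite !dotcE rmorph_sum; apply: eq_bigr => i _.
by rewrite rmorphM /= conjCK mulrC.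
Qed.

Lemma dotcDl (n : nat) (u v w : 'cV[C]_n) : dotc (u + v) w = dotc u w + dotc v w.
Proof. by rewrite dotcC dotcDr rmorphD /= -!dotcC. Qed.

Lemma dotcZl (n : nat) (a : C) (u v : 'cV[C]_n) : dotc (a *: u) v = a^* * dotc u v.
Proof. by rewrite dotcC dotcZr rmorphM /= -dotcC. Qed.

Lemma dotc_mull (m n : nat) (A : 'M[C]_(m, n)) (u : 'cV[C]_n) (v : 'cV[C]_m) :
  dotc (A *m u) v = dotc u (A^t* *m v).
Proof. by rewrite /dotc trmx_mul map_mxM mulmxA. Qed.

Lemma dotc_ge0 (n : nat) (u : 'cV[C]_n) : 0 <= dotc u u.
Proof. by rewrite dotcE sumr_ge0 // => i _; rewrite mulrC mul_conjC_ge0. Qed.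

Lemma dotc_eq0 (n : nat) (u : 'cV[C]_n) : dotc u u = 0 -> u = 0.
Proof.
move=> /eqP; rewrite dotcE psumr_eq0 => [/allP u0|i _].
  apply/colP => i; have := u0 i (mem_index_enum i).
  by rewrite mulrC mul_conjC_eq0 mxE => /eqP.
by rewrite mulrC mul_conjC_ge0.
Qed.

(** * Spectrum and kernel of the block matrix over the complex numbers *)

Variables p q : nat.
Variables (A : 'M[C]_p) (B : 'M[C]_q) (Y : 'M[C]_(p, q)).

(** The complex counterpart of [Mmx], with adjoints for transposes so that [Y] moves across
    [dotc]. *)
Definition hermMmx : 'M[C]_(p + q + p) :=
  block_mx
    (block_mx    (- A)             (- Y)
              (- (Y^t* *m A)) (- (Y^t* *m Y) - B))   (col_mx A (Y^t* *m A))
    (row_mx       0                  Y)                    (- A).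

(** The second block is kept as [Y^t*] times the first, minus [B *m y], so that an equation for the
    first can be substituted into it. *)
Lemma mul_hermMmx (x w : 'cV[C]_p) (y : 'cV[C]_q) :
  hermMmx *m col_mx (col_mx x y) w =
  col_mx (col_mx (- (A *m x) - Y *m y + A *m w)
                 (Y^t* *m (- (A *m x) - Y *m y + A *m w) - B *m y))
         (Y *m y - A *m w).
Proof.
rewrite /hermMmx mul_block_col mul_block_col mul_col_mx add_col_mx.
rewrite mul_row_col mul0mx add0r !mulNmx mulmxDl !mulNmx !mulmxDr !mulmxN !mulmxA.
congr (col_mx (col_mx _ _) _).
by rewrite addrA [LHS]addrAC.
Qed.

Hypotheses (A_herm : A^t* = A) (B_herm : B^t* = B).
Hypothesis A_psd : forall x, 0 <= dotc x (A *m x).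
Hypothesis B_psd : forall x, 0 <= dotc x (B *m x).

Let colE (v : 'cV[C]_(p + q + p)) :
  v = col_mx (col_mx (usubmx (usubmx v)) (dsubmx (usubmx v))) (dsubmx v).
Proof. by rewrite !vsubmxK. Qed.

(** Pairing with [u] gives [z * dotc u u <= 0]; a non-zero [u] would make [z] real and nonpositive,
    hence zero. *)
Let Re_ge0_eq0 (n : nat) (z : C) (L : 'M[C]_n) (u : 'cV[C]_n) :
  (forall x, 0 <= dotc x (L *m x)) ->
  0 <= 'Re z -> z != 0 -> - (L *m u) = z *: u -> u = 0.
Proof.
move=> Lpsd Rez z0 Lu; apply: dotc_eq0.
have /eqP := congr1 (dotc u) Lu; rewrite dotcNr dotcZr => /eqP E.
have d0 := dotc_ge0 u; have [->//|dn0] := eqVneq (dotc u u) 0.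
have dp : 0 < dotc u u by rewrite lt0r dn0.
have zle : z <= 0 by rewrite -(pmulr_lle0 _ dp) -E oppr_le0.
have zr : z \is Num.real by rewrite ler0_real.
move: Rez; rewrite (Creal_ReP _ zr) => z_ge0.
by case/negP: z0; rewrite eq_le zle z_ge0.
Qed.

Lemma hermMmx_eigenvalue_Re (z : C) :
  eigenvalue hermMmx z -> z != 0 -> 'Re z < 0.
Proof.
case/eigenvalue_colP => v; rewrite (colE v).
set x := usubmx _; set y := dsubmx (usubmx v); set w := dsubmx v.
rewrite mul_hermMmx !scale_col_mx => /eq_col_mx[/eq_col_mx[Ex Ey] Ew] vn0 z0.
rewrite real_ltNge ?Creal_Re ?real0 //; apply: contra vn0 => Rez.
rewrite Ex in Ey.
have Exw : - (A *m x) = z *: x + z *: w.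
  by rewrite -Ex -Ew -!addrA (addrCA (A *m w)) subrr addr0 addNr addr0.
have y0 : y = 0.
  have E1 := congr1 (dotc x) Ex.
  have E2 := congr1 (dotc (A *m x)) Exw.
  have E3 := congr1 (dotc y) Ey.
  move: E1 E2 E3; rewrite -!scalemxAr !(dotcDr, dotcNr, dotcZr).
  have -> : dotc (A *m x) x = dotc x (A *m x) by rewrite dotc_mull A_herm.
  have -> : dotc (A *m x) w = dotc x (A *m w) by rewrite dotc_mull A_herm.
  have -> : dotc y (Y^t* *m x) = (dotc x (Y *m y))^*.
    by rewrite -dotc_mull dotcC.
  set X := dotc x x; set a := dotc x (A *m x); set b := dotc (A *m x) _.
  set t := dotc x (Y *m y); set s := dotc x (A *m w).
  set m := dotc y y; set c := dotc y (B *m y).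
  move=> E1 E2 E3.
  have [X_ge0 b_ge0 m_ge0] : [/\ 0 <= X, 0 <= b & 0 <= m] by split; apply: dotc_ge0.
  have [a_ge0 c_ge0] : 0 <= a /\ 0 <= c by split; [apply: A_psd | apply: B_psd].
  have real_conj (k : C) : 0 <= k -> k^* = k by move/ger0_real/conj_Creal.
  (* Conjugation replaces [t^*] by the [t] that occurs in [E1]. *)
  have {}E3 : z^* * t - c = z^* * m.
    move/(congr1 Num.conj): E3; rewrite rmorphB !rmorphM /= conjCK.
    by rewrite (real_conj c) // (real_conj m).
  set N := z * z^*.
  have N_gt0 : 0 < N by rewrite mul_conjC_gt0.
  (* The cross terms [t] and [s], whose signs are unknown, are eliminated from [E1]; the factor [N]
     clears the denominators [z^*] and [z]. *)
  have E4 : z * (N * X) + 2 * N * a + N * m + z * c + z^* * b = 0.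
    have Nt : N * t = z * (z^* * m + c) by rewrite -E3 /N; ring.
    have Ns : N * s = z^* * (- b - z * a) by rewrite E2 /N; ring.
    have -> : z * (N * X) = N * (- a - t + s) by rewrite E1; ring.
    by rewrite mulrDr Ns mulrBr Nt /N; ring.
  (* This is the real part of [E4]. Both summands are nonnegative, which forces [2 * a + m <= 0] and
     so [m = 0]. *)
  have Nm0 : 0 = 'Re z * (N * X + c + b) + N * (2 * a + m).
    have := congr1 (fun u => u + u^*) E4.
    rewrite !(rmorphD, rmorphM, rmorph0) /= !conjCK conjC1 addr0.
    rewrite (real_conj X) // (real_conj a) // (real_conj b) // (real_conj c) //.
    rewrite (real_conj m) // ReE => E5; apply: (@mulfI _ 2); first by rewrite pnatr_eq0.
    by rewrite mulr0 -E5 /N; field.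
  have S1 : 0 <= 'Re z * (N * X + c + b).
    by apply: mulr_ge0 => //; do 2![apply: addr_ge0 => //]; rewrite mulr_ge0 ?(ltW N_gt0).
  have S2 : 0 <= 2 * a + m by rewrite addr_ge0 ?mulr_ge0.
  apply: dotc_eq0; apply/eqP; rewrite eq_le dotc_ge0 andbT -/m.
  rewrite (le_trans (_ : m <= 2 * a + m)) //.
    by rewrite lerDr mulr_ge0.
  by rewrite -(pmulr_rle0 _ N_gt0) Nm0 lerDr.
have w0 : w = 0.
  apply: (Re_ge0_eq0 A_psd Rez z0).
  by move: Ew; rewrite y0 mulmx0 sub0r.
have x0 : x = 0.
  apply: (Re_ge0_eq0 A_psd Rez z0).
  by rewrite Exw w0 scaler0 addr0.
by rewrite x0 y0 w0 !col_mx0.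
Qed.

Lemma hermMmx_ker_sq (v : 'cV[C]_(p + q + p)) :
  hermMmx *m (hermMmx *m v) = 0 -> hermMmx *m v = 0.
Proof.
rewrite (colE v); set x' := usubmx _; set y' := dsubmx (usubmx v); set w' := dsubmx v.
rewrite mul_hermMmx.
set x := _ + A *m w'; set y := _ - B *m y'; set w := _ - A *m w'.
rewrite mul_hermMmx -[0]vsubmxK -[usubmx 0]vsubmxK => /eq_col_mx[/eq_col_mx[]].
rewrite !linear0 => Ex Ey Ew.
rewrite Ex mulmx0 sub0r in Ey.
have By : B *m y = 0 by apply/eqP; rewrite -oppr_eq0 Ey.
have Yy : Y *m y = A *m w by apply/eqP; rewrite -subr_eq0 Ew.
have Ax : A *m x = 0.
  by apply/eqP; rewrite -oppr_eq0 -{}Ex Yy subrK.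
have xw : x + w = - (A *m x').
  by rewrite /x /w -!addrA (addrCA (A *m w')) subrr addr0 addNr addr0.
(* With [y = Y^* x - B y'], moving adjoints gives [<y, y> = <A w, x> - <B y, y'>], and both terms
   vanish by [A x = 0] and [B y = 0]. *)
have y0 : y = 0.
  apply: dotc_eq0; rewrite {2}/y -/x dotcDr dotcNr -dotc_mull Yy dotc_mull A_herm Ax.
  by rewrite -{1}B_herm -dotc_mull By dotc0r dotc0l subrr.
have Aw : A *m w = 0 by rewrite -Yy y0 mulmx0.
(* [<A x', A x'>] equals [- <x', A (x + w)>], where [A] kills both [x] and [w]. *)
have Ax' : A *m x' = 0.
  apply: dotc_eq0; rewrite dotc_mull A_herm -[A *m x']opprK -xw mulmxN mulmxDr.
  by rewrite Ax Aw addr0 oppr0 dotc0r.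
(* Now [x = - Y y' + A w'], and [y = 0] means [Y^* x = B y']; hence [<x, x> = - <y', B y'>], which
   is nonpositive. *)
have x0 : x = 0.
  apply: dotc_eq0; apply/eqP; rewrite eq_le dotc_ge0 andbT.
  have YxE : Y^t* *m x = B *m y' by apply/eqP; rewrite -subr_eq0 -/y y0.
  rewrite {2}/x Ax' oppr0 sub0r dotcDr dotcNr -{1}A_herm -dotc_mull Ax.
  rewrite dotc0l addr0 -[Y]trmxCK -dotc_mull YxE dotc_mull B_herm.
  by rewrite oppr_le0.
have w0 : w = 0 by move: xw; rewrite x0 add0r Ax' oppr0.
by rewrite x0 y0 w0 !col_mx0.
Qed.

End Hermitian.

(** * Passage from real matrices to complex ones *)

Lemma cmx_adj (R : realType) (m n : nat) (A : 'M[R]_(m, n)) : (cmx A)^t* = cmx A^T.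
Proof. by apply/matrixP => i j; rewrite !mxE; apply: conjc_real. Qed.

Lemma cmx_herm (R : realType) (n : nat) (L : 'M[R]_n) : psdmx L -> (cmx L)^t* = cmx L.
Proof.
by case=> /is_hermitianmxP; rewrite scale1r map_mx_id // => Lsym _; rewrite cmx_adj -Lsym.
Qed.

Lemma dotc_cmx (R : realType) (n : nat) (L : 'M[R]_n) (a b : 'cV[R]_n) :
  dotc (cmx a) (cmx L *m cmx b) = ((a^T *m L *m b) 0 0)%:C%C.
Proof. by rewrite /dotc cmx_adj -!map_mxM mxE mulmxA. Qed.

(** Splitting [x] as [a + i b], the cross terms cancel by symmetry of [L], leaving the real form at
    [a] plus that at [b]. *)
Lemma cmx_psd (R : realType) (n : nat) (L : 'M[R]_n) (x : 'cV[R[i]]_n) :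
  psdmx L -> 0 <= dotc x (cmx L *m x).
Proof.
move=> Lpsd; have Lherm := cmx_herm Lpsd; have [_ Lge0] := Lpsd.
pose a := map_mx (@complex.Re R) x; pose b := map_mx (@complex.Im R) x.
have -> : x = cmx a + 'i%C *: cmx b.
  by apply/colP => k; rewrite !mxE; apply: complexE.
have Lab : dotc (cmx a) (cmx L *m cmx b) = dotc (cmx b) (cmx L *m cmx a).
  rewrite dotcC dotc_mull Lherm !dotc_cmx; apply: conjc_real.
rewrite mulmxDr -scalemxAr !(dotcDl, dotcDr, dotcZl, dotcZr) Lab !dotc_cmx.
have -> : 'i%C^* = - 'i%C :> R[i] by apply/eqP; rewrite eq_complex /= oppr0 !eqxx.
rewrite mulrA !mulNr -expr2 sqr_i mulN1r opprK addrA addrK.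
by rewrite -rmorphD lecR addr_ge0.
Qed.

Lemma cmx_Mmx (R : realType) (p q : nat)
    (L1 : 'M[R]_p) (L2 : 'M[R]_q) (Y : 'M[R]_(p, q)) :
  cmx (Mmx L1 L2 Y) = hermMmx (cmx L1) (cmx L2) (cmx Y).
Proof.
rewrite /hermMmx cmx_adj /Mmx /cmx !(map_block_mx, map_col_mx, map_row_mx).
by rewrite !(map_mxD, map_mxN, map_mxM) map_mx0.
Qed.

Theorem lemma2 (R : realType) (p q : nat)
    (L1 : 'M[R]_p) (L2 : 'M[R]_q) (Y : 'M[R]_(p, q))
    (hL1 : psdmx L1) (hL2 : psdmx L2) :
  (forall z : R[i],
      eigenvalue (cmx (Mmx L1 L2 Y)) z -> z != 0 -> complex.Re z < 0) /\
  (eigenvalue (cmx (Mmx L1 L2 Y)) 0 ->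
     alg_mult (cmx (Mmx L1 L2 Y)) 0 = geom_mult (cmx (Mmx L1 L2 Y)) 0).
Proof.
rewrite cmx_Mmx; have hA := cmx_herm hL1; have hB := cmx_herm hL2.
have pA x := cmx_psd x hL1; have pB x := cmx_psd x hL2.
split=> [z zE z0|_].
  by rewrite -ltcR complexRe (hermMmx_eigenvalue_Re hA pA pB zE).
by apply/alg_mult0_rank_sq/rank_sq_ker => v; apply: hermMmx_ker_sq.
Qed.
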